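(* Let $C$ be the pseudo-arc, let $\mathcal{U}=\{U_1,\dots,U_7\}$ be a taut chain cover of $C$ and assume that the continuous map $f:C\to C$ stretches $\mathcal{U}$. Then for every integer $k\ge2$ there exists a closed set $D\subset\overline{U_4}$ with $f(D)\subset D$ such that $(D,f|_D)$ is an extension of the full one-sided shift $(\Sigma_k^+,\sigma)$ on $k$ symbols, i.e. there is a continuous surjection $\pi:D\to\Sigma_k^+$ with $\pi\circ f=\sigma\circ\pi$.
   Context: A chain cover of a continuum $X$ is a finite sequence $U_1,\dots,U_n$ of open sets covering $X$ with $U_i\cap U_j\ne\emptyset$ iff $|i-j|\le1$; it is taut if moreover $\overline{U_i}\cap\overline{U_j}\ne\emptyset$ iff $|i-j|\le1$. A map $f$ stretches a taut chain cover $\{U_1,\dots,U_7\}$ if $f(U_3)\subset U_1$ and $f(U_5)\subset U_7$, or $f(U_5)\subset U_1$ and $f(U_3)\subset U_7$. $\Sigma_k^+=\{1,\dots,k\}^{\mathbb{N}}$ with the product topology and $\sigma$ the left shift. *)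

(* Defs.v *)
From HB Require Import structures.
From mathcomp Require Import all_boot all_order all_algebra.
From mathcomp Require Import all_classical all_reals all_analysis.
Set Implicit Arguments. Unset Strict Implicit. Unset Printing Implicit Defensive.
Import Order.TTheory GRing.Theory Num.Theory.
Local Open Scope classical_set_scope.

Definition subcontinuum {T : topologicalType} (K : set T) : Prop :=
  K !=set0 /\ compact K /\ connected K.

Definition indecomposable {T : topologicalType} (K : set T) : Prop :=
  ~ (exists A B : set T, subcontinuum A /\ subcontinuum B /\
       A `<=` K /\ B `<=` K /\ A <> K /\ B <> K /\ A `|` B = K).

Definition hereditarily_indecomposable (T : topologicalType) : Prop :=
  forall K : set T, subcontinuum K -> indecomposable K.

Definition chain_cover {T : topologicalType} (n : nat) (U : nat -> set T) : Prop :=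
  (forall i, (1 <= i <= n)%N -> open (U i)) /\
  (forall x : T, exists2 i, (1 <= i <= n)%N & U i x) /\
  (forall i j, (1 <= i <= n)%N -> (1 <= j <= n)%N ->
     (U i `&` U j !=set0 <-> (i <= j.+1 /\ j <= i.+1)%N)).

Definition taut_chain_cover {T : topologicalType} (n : nat) (U : nat -> set T) : Prop :=
  chain_cover n U /\
  (forall i j, (1 <= i <= n)%N -> (1 <= j <= n)%N ->
     (closure (U i) `&` closure (U j) !=set0 <-> (i <= j.+1 /\ j <= i.+1)%N)).

Definition chainable (T : topologicalType) : Prop :=
  forall V : set (set T), (forall W, V W -> open W) ->
    (forall x : T, exists2 W, V W & W x) ->
    exists n (U : nat -> set T), chain_cover n U /\
      forall i, (1 <= i <= n)%N -> exists2 W, V W & U i `<=` W.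

Definition metric_continuum {R : realType} (T : pseudoMetricType R) : Prop :=
  hausdorff_space T /\ compact [set: T] /\ connected [set: T] /\
  exists x y : T, x <> y.

(* The pseudo-arc: (by Bing's characterization) the unique, up to
   homeomorphism, hereditarily indecomposable chainable metric continuum. *)
Definition pseudo_arc {R : realType} (T : pseudoMetricType R) : Prop :=
  metric_continuum T /\ chainable T /\ hereditarily_indecomposable T.

Definition stretches {T : topologicalType} (f : T -> T) (U : nat -> set T) : Prop :=
  (f @` U 3 `<=` U 1 /\ f @` U 5 `<=` U 7) \/
  (f @` U 5 `<=` U 1 /\ f @` U 3 `<=` U 7).

Notation Sigma k := {ptws nat -> discrete_topology 'I_k}.
Definition one_sided_shift {k : nat} (s : Sigma k) : Sigma k := fun n => s n.+1.

(* Main.v *)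
Require Import Defs.
From HB Require Import structures.
From mathcomp Require Import all_boot all_order all_algebra.
From mathcomp Require Import all_classical all_reals all_analysis.
Local Open Scope classical_set_scope.

(** In a hereditarily indecomposable space two subcontinua that meet are nested.
    Let [A], [B] be closed with disjoint closed neighbourhoods [A'], [B'].  The
    points whose component off the interior of [B'] meets [A] form a closed set
    [P]; exchanging the two sides gives a closed set [Q].  A component of the
    first kind is never nested with one of the second kind, so [P] and [Q] are
    disjoint, while by boundary bumping every continuum from [A] to [B] contains
    a continuum from [A'] to [B'] inside [P] and another inside [Q].  Splitting
    [P] again, between interpolated neighbourhoods, yields arbitrarily many
    disjoint closed sets [D_i] that each contain a piece of every continuum going
    from [U_1] to [U_7]; bumping twice more cuts these pieces down to [U_4], where
    they still run from [closure U_3] to [closure U_5].  The map [f] sends such a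
    piece to a continuum from [closure U_1] to [closure U_7], so the [D_i] form a
    horseshoe and itineraries give the factor map onto the shift. *)

(** * Compactness and quasicomponents *)

Lemma compact_directed_meet {T : topologicalType} (K : set T) (F : set (set T)) :
  compact K -> F !=set0 ->
  (forall E, F E -> [/\ closed E, E `<=` K & E !=set0]) ->
  (forall E G, F E -> F G -> exists2 H, F H & H `<=` E `&` G) ->
  exists x, forall E, F E -> E x.
Proof.
move=> cK F0 FE Fdir.
have PF : ProperFilter (filter_from F id).
  apply: filter_from_proper; last by move=> E /FE[].
  by apply: filter_from_filter.
have [|x [_]] := cK _ PF.
  by case: F0 => E FEE; exists E => //; case: (FE _ FEE).
rewrite clusterE => clx; exists x => E FEE.
have [cE _ _] := FE _ FEE.
by apply: cE; apply: clx; exists E.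
Qed.

Definition relclopen {T : topologicalType} (Z E : set T) :=
  [/\ closed E, closed (Z `\` E) & E `<=` Z].

(** For [x] outside [Z] the condition is vacuous and the set is the whole space, hence the
    assumptions [Z x] below. *)
Definition quasicomponent {T : topologicalType} (Z : set T) (x : T) : set T :=
  [set y | forall E, relclopen Z E -> E x -> E y].

Lemma closed_quasicomponent {T : topologicalType} (Z : set T) (x : T) :
  closed (quasicomponent Z x).
Proof.
have -> : quasicomponent Z x = \bigcap_(E in [set E | relclopen Z E /\ E x]) E.
  apply/seteqP; split => y qy E; first by case; exact: qy.
  by move=> ? ?; apply: qy.
by apply: closed_bigI => E [[]].
Qed.

Lemma relclopen_id {T : topologicalType} (Z : set T) : closed Z -> relclopen Z Z.
Proof. by move=> cZ; split => //; rewrite setDv; exact: closed0. Qed.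

Lemma quasicomponent_sub {T : topologicalType} (Z : set T) (x : T) :
  closed Z -> Z x -> quasicomponent Z x `<=` Z.
Proof. by move=> cZ Zx y; apply => //; exact: relclopen_id. Qed.

Lemma quasicomponent_refl {T : topologicalType} (Z : set T) (x : T) :
  quasicomponent Z x x.
Proof. by []. Qed.

Lemma relclopenI {T : topologicalType} (Z E G : set T) :
  relclopen Z E -> relclopen Z G -> relclopen Z (E `&` G).
Proof.
move=> [cE cZE EZ] [cG cZG GZ]; split; first exact: closedI.
  by rewrite setDIr; exact: closedU.
by move=> y [/EZ].
Qed.

(** Otherwise the traces on [F] of the relatively clopen sets around [x] are nonempty, closed and
    directed by intersection; a common point lies in the quasicomponent and in [F]. *)
Lemma quasicomponent_separation {T : topologicalType} (Z F : set T) (x : T) :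
  compact Z -> closed Z -> Z x -> closed F ->
  quasicomponent Z x `&` F = set0 ->
  exists2 E, relclopen Z E & E x /\ E `&` F = set0.
Proof.
move=> kZ cZ Zx cF QF; apply: contrapT => nE.
have := @compact_directed_meet T Z [set E `&` F | E in [set E | relclopen Z E /\ E x]] kZ.
case.
- by exists (Z `&` F), Z => //; split => //; exact: relclopen_id.
- move=> _ [E [ZE Ex] <-]; case: (ZE) => cE _ EZ; split.
  + exact: closedI.
  + by move=> y [/EZ].
  + by apply/set0P/eqP => EF; apply: nE; exists E.
- move=> _ _ [E [ZE Ex] <-] [G [ZG Gx] <-].
  exists (E `&` G `&` F); last by move=> y [[]].
  by exists (E `&` G) => //; split=> //; exact: relclopenI.
- move=> y yI.
  have [_ Fy] : (Z `&` F) y.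
    by apply: yI; exists Z => //; split => //; exact: relclopen_id.
  suff : (quasicomponent Z x `&` F) y by rewrite QF.
  split => // E ZE Ex.
  by have [] : (E `&` F) y by apply: yI; exists E.
Qed.

Lemma normal_interpolate {T : topologicalType} (A G : set T) :
  hausdorff_space T -> compact [set: T] -> closed A -> A `<=` G° ->
  exists B, [/\ closed B, A `<=` B° & B `<=` G°].
Proof.
move=> hT kT cA AG.
have [|N AN NG] := compact_normal hT kT cA (t := G°).
  by apply/set_nbhsP; exists G°; split => //; exact: open_interior.
exists (closure N); split => //; first exact: closed_closure.
move=> x /AN; apply: filterS; exact: subset_closure.
Qed.

(** Enclose [G] in the interior of a closed [B] missing [H]. The quasicomponent avoids the boundary
    of [B], so some relatively clopen [E] around [x] does; then [E] cut with [B] is relatively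
    clopen and excludes [H]. *)
Lemma quasicomponent_half {T : topologicalType} (Z G H : set T) (x : T) :
  hausdorff_space T -> compact [set: T] -> closed Z -> Z x ->
  closed G -> closed H -> G `&` H = set0 ->
  quasicomponent Z x = G `|` H -> G x -> H = set0.
Proof.
move=> hT kT cZ Zx cG cH GH0 QE Gx.
have [|B [cB GB BH]] := @normal_interpolate T G (~` H) hT kT cG.
  by rewrite (interior_id _).1; [apply/disjoints_subset | exact: closed_openC].
have kZ : compact Z by apply: subclosed_compact kT _.
have [||E ZE [Ex EF]] := @quasicomponent_separation T Z (B `\` B°) x kZ cZ Zx.
- by apply: closedI => //; apply: open_closedC; exact: open_interior.
- rewrite QE -subset0 => y [[Gy [_]|Hy [/BH By _]]]; first by apply; exact: GB.
  by move/interior_subset : By.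
- have EB : E `&` B° = E `&` B.
    apply/seteqP; split => y [Ey By]; split => //; first exact: interior_subset.
    apply: contrapT => nBy; suff : (E `&` (B `\` B°)) y by rewrite EF.
    by [].
  have [cE cZE EZ] := ZE.
  have ZEB : relclopen Z (E `&` B°).
    split; first by rewrite EB; exact: closedI.
    + rewrite (_ : _ `\` _ = (Z `\` E) `|` (E `&` ~` B°)).
        apply: closedU => //; apply: closedI => //.
        by apply: open_closedC; exact: open_interior.
      apply/seteqP; split => y.
        move=> [Zy nEB]; have [Ey|nEy] := pselect (E y); last by left.
        by right; split => // By; apply: nEB.
      by move=> [[Zy nEy]|[Ey nBy]]; split; [|case|exact: EZ|case].
    + by move=> y [/EZ].
  rewrite -subset0 => y Hy.
  have Qy : quasicomponent Z x y by rewrite QE; right.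
  have [_ /BH /interior_subset] : (E `&` B) y.
    by rewrite -EB; apply: Qy ZEB _; split => //; exact: GB.
  by apply.
Qed.

Lemma connected_quasicomponent {T : topologicalType} (Z : set T) (x : T) :
  hausdorff_space T -> compact [set: T] -> closed Z -> Z x ->
  connected (quasicomponent Z x).
Proof.
move=> hT kT cZ Zx B [b Bb] [W oW BW] [F cF BF].
have cQ := closed_quasicomponent Z x.
set Q := quasicomponent Z x in cQ BW BF *.
have cB : closed B by rewrite BF; exact: closedI.
have QBE : Q `\` B = Q `&` ~` W.
  rewrite BW; apply/seteqP; split => y [Qy nB]; split => //; last by case.
  by move=> Wy; apply: nB.
have cQB : closed (Q `\` B).
  by rewrite QBE; apply: closedI => //; exact: open_closedC.
have BQ : B `<=` Q by rewrite BW; exact: subIsetl.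
have [Bx|nBx] := pselect (B x).
  have QB0 : Q `\` B = set0.
    apply: (@quasicomponent_half T Z B (Q `\` B) x) => //.
      by rewrite setDE setICA setICr setI0.
    by rewrite setDUK.
  apply/seteqP; split => // y Qy; apply: contrapT => nBy.
  by have : (Q `\` B) y by []; rewrite QB0.
suff : B = set0 by move=> B0; rewrite B0 in Bb.
apply: (@quasicomponent_half T Z (Q `\` B) B x) => //.
- by rewrite setIC setDE setICA setICr setI0.
- by rewrite setUC setDUK.
- by split => //; exact: quasicomponent_refl.
Qed.

Lemma subcontinuum_quasicomponent {T : topologicalType} (Z : set T) (x : T) :
  hausdorff_space T -> compact [set: T] -> closed Z -> Z x ->
  subcontinuum (quasicomponent Z x).
Proof.
move=> hT kT cZ Zx; split; first by exists x.
split; last exact: connected_quasicomponent.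
by apply: subclosed_compact kT _ => //; exact: closed_quasicomponent.
Qed.

(** * Boundary bumping and nested continua *)

Lemma connected_closed_split {T : topologicalType} (K E F : set T) :
  connected K -> closed E -> closed F -> E `&` F = set0 -> K = E `|` F ->
  E !=set0 -> F = set0.
Proof.
move=> cK cE cF EF KE E0.
suff EK : E = K.
  by rewrite -subset0 -EF => y Fy; split => //; rewrite EK KE; right.
apply: cK => //; [exists (~` F); first exact: closed_openC | exists E => //].
  rewrite KE setIUl setICr setU0; apply/esym/setIidPl.
  exact/disjoints_subset.
by rewrite KE setIUl setIid; apply/esym/setUidPl; rewrite setIC EF.
Qed.

(* Boundary bumping. *)
Lemma subcontinuum_bump {T : topologicalType} (K V F : set T) (a : T) :
  hausdorff_space T -> compact [set: T] -> subcontinuum K ->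
  open V -> closed F -> V `<=` F -> K a -> ~ V a -> K `&` F !=set0 ->
  subcontinuum (quasicomponent (K `\` V) a) /\
  quasicomponent (K `\` V) a `&` F !=set0.
Proof.
move=> hT kT [_ [kK nK]] oV cF VF Ka nVa KF.
have cK := compact_closed hT kK.
have cZ : closed (K `\` V) by apply: closedI => //; exact: open_closedC.
have Za : (K `\` V) a by [].
split; first exact: subcontinuum_quasicomponent.
apply/set0P/eqP => QF.
have kZ : compact (K `\` V) by apply: subclosed_compact kT _.
have [E [cE cZE EZ] [Ea EF]] := quasicomponent_separation _ F a kZ cZ Za cF QF.
(* If the quasicomponent missed [F], [K] would split into [E] and a closed remainder that contains
   the nonempty trace of [K] on [F]. *)
have : (K `\` V) `\` E `|` K `&` F = set0.
  apply: (connected_closed_split K E _ nK cE) => //; last by exists a.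
  - by apply: closedU => //; exact: closedI.
  - rewrite setIUr setDE setICA setICr setI0 set0U setICA EF setI0 //.
  - apply/seteqP; split => y; last by case=> [/EZ[]|[[[]]|[]]].
    move=> Ky; have [Ey|nEy] := pselect (E y); [by left|right].
    by have [/VF Vy|nVy] := pselect (V y); [right|left].
by case: KF => y KFy e; suff : set0 y by []; rewrite -e; right.
Qed.

(** If neither contained the other, the union would be a decomposable subcontinuum. *)
Lemma hereditarily_indecomposable_nested {T : topologicalType} (K L : set T) :
  hereditarily_indecomposable T -> subcontinuum K -> subcontinuum L ->
  K `&` L !=set0 -> K `<=` L \/ L `<=` K.
Proof.
move=> hi sK sL KL; apply: contrapT => /not_orP[nKL nLK].
have [[x Kx] [kK nK]] := sK; have [_ [kL nL]] := sL.
apply: (hi (K `|` L)).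
  by split; [exists x; left|split; [exact: compactU|exact: connectedU]].
exists K, L; do 4?split => //.
split=> [|]; first by move=> e; apply: nLK; rewrite e; exact: subsetUr.
by split => // e; apply: nKL; rewrite e; exact: subsetUl.
Qed.

(** * Continua crossing between two closed sets *)

Definition crosses {T : topologicalType} (A B K : set T) : Prop :=
  [/\ subcontinuum K, K `&` A !=set0 & K `&` B !=set0].

(* Phrasing this with quasicomponents instead of components makes closedness of
   the set a direct consequence of compactness. *)
Definition reach {T : topologicalType} (Y V A : set T) : set T :=
  [set x | (Y `\` V) x /\ quasicomponent (Y `\` V) x `&` A !=set0].

Lemma connected_sub_quasicomponent {T : topologicalType} (Z K : set T) (x : T) :
  closed K -> connected K -> K `<=` Z -> K x -> K `<=` quasicomponent Z x.
Proof.
move=> cK nK KZ Kx y Ky E [cE cZE EZ] Ex; apply: contrapT => nEy.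
have : K `&` (Z `\` E) = set0.
  apply: (connected_closed_split K (K `&` E)) => //; try exact: closedI.
  - by rewrite setIACA setDE [E `&` _]setICA setICr !setI0.
  - rewrite -setIUr setDUK //; exact/esym/setIidPl.
  - by exists x.
by move=> e; suff : set0 y by []; rewrite -e; split => //; split => //; exact: KZ.
Qed.

(** By separation, a point of [Y] off [V] fails to reach [A] exactly when a relatively clopen set
    around it misses [A]; removing all these sets leaves a closed set. *)
Lemma closed_reach {T : topologicalType} (Y V A : set T) :
  compact [set: T] -> closed Y -> open V -> closed A -> closed (reach Y V A).
Proof.
move=> kT cY oV cA; set Z := Y `\` V.
have cZ : closed Z by apply: closedI => //; exact: open_closedC.
have kZ : compact Z by apply: subclosed_compact kT _.
rewrite (_ : reach Y V A =
  Z `&` \bigcap_(E in [set E | relclopen Z E /\ E `&` A = set0]) (Z `\` E)).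
  by apply: closedI => //; apply: closed_bigI => E [[]].
apply/seteqP; split => x.
  move=> [Zx [y [Qy Ay]]]; split => // E [ZE EA]; split => // Ex.
  by have : (E `&` A) y; [split => //; exact: Qy|rewrite EA].
move=> [Zx ZE]; split => //; apply/set0P/eqP => QA.
have [E rE [Ex EA]] := quasicomponent_separation _ A x kZ cZ Zx cA QA.
by have [] : (Z `\` E) x by apply: ZE.
Qed.

Lemma crossesC {T : topologicalType} (A B K : set T) :
  crosses A B K -> crosses B A K.
Proof. by case. Qed.

(** Bumping from a point of [A] keeps a piece of [K] off [B'°] that still touches [B']. This
    connected piece contains the starting point, so each of its points reaches [A]. *)
Lemma crosses_reach {T : topologicalType} (Y A B B' K : set T) :
  hausdorff_space T -> compact [set: T] -> closed B' -> B `<=` B' ->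
  A `&` B' = set0 -> K `<=` Y -> crosses A B K ->
  exists2 K', crosses A B' K' & K' `<=` K `&` reach Y B'° A.
Proof.
move=> hT kT cB' BB' AB' KY [sK [a [Ka Aa]] [b [Kb Bb]]].
have nB'a : ~ B'° a.
  by move=> /interior_subset B'a; suff : (A `&` B') a by rewrite AB'.
have [|||sQ QB'] := subcontinuum_bump _ B'° B' a hT kT sK _ cB' _ Ka nB'a.
- exact: open_interior.
- exact: interior_subset.
- by exists b; split => //; exact: BB'.
have cK : closed K by apply: compact_closed => //; case: sK => _ [].
have QK : quasicomponent (K `\` B'°) a `<=` K `\` B'°.
  apply: quasicomponent_sub => //.
  by apply: closedI => //; apply: open_closedC; exact: open_interior.
exists (quasicomponent (K `\` B'°) a); first by split => //; exists a; split.
move=> y Qy; have [Ky nB'y] := QK _ Qy; split => //; split; first by split => //; exact: KY.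
exists a; split => //.
have [_ [_ nQ]] := sQ.
apply: (connected_sub_quasicomponent _ (quasicomponent (K `\` B'°) a)) => //.
  exact: closed_quasicomponent.
by move=> z /QK[/KY].
Qed.

(* A continuum reaching [A] off [B'] and one reaching [B] off [A'] cannot be
   nested, hence cannot meet. *)
Lemma reach_disjoint {T : topologicalType} (Y A A' B B' : set T) :
  hausdorff_space T -> compact [set: T] -> hereditarily_indecomposable T ->
  closed Y -> A `<=` A'° -> B `<=` B'° ->
  reach Y B'° A `&` reach Y A'° B = set0.
Proof.
move=> hT kT hi cY AA' BB'; rewrite -subset0 => x.
move=> [[Zx [a [Qa Aa]]] [Z'x [b [Qb Bb]]]].
have cZ (V : set T) : open V -> closed (Y `\` V).
  by move=> oV; apply: closedI => //; exact: open_closedC.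
have oA' := @open_interior _ A'; have oB' := @open_interior _ B'.
have [|||QQ|QQ] := @hereditarily_indecomposable_nested T
  (quasicomponent (Y `\` B'°) x) (quasicomponent (Y `\` A'°) x) hi.
- by apply: subcontinuum_quasicomponent => //; exact: cZ.
- by apply: subcontinuum_quasicomponent => //; exact: cZ.
- by exists x; split.
- by have [_] := quasicomponent_sub _ _ (cZ _ oA') Z'x _ (QQ _ Qa); apply; exact: AA'.
- by have [_] := quasicomponent_sub _ _ (cZ _ oB') Zx _ (QQ _ Qb); apply; exact: BB'.
Qed.

Lemma crossesS {T : topologicalType} (A A' B B' K : set T) :
  A `<=` A' -> B `<=` B' -> crosses A B K -> crosses A' B' K.
Proof.
move=> AA' BB' [sK [a [Ka Aa]] [b [Kb Bb]]]; split => //.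
  by exists a; split => //; exact: AA'.
by exists b; split => //; exact: BB'.
Qed.

(** Each splitting replaces [A], [B] by larger [A1], [B1] while [A'], [B'] stay fixed: one of two
    disjoint reach sets becomes a [D i], the other is split again. After [k] splittings there are
    [k.+1] sets. *)
Lemma crossing_family {T : topologicalType} (k : nat) (Y A A' B B' : set T) :
  hausdorff_space T -> compact [set: T] -> hereditarily_indecomposable T ->
  closed Y -> closed A -> closed A' -> closed B -> closed B' ->
  A `<=` A'° -> B `<=` B'° -> A' `&` B' = set0 ->
  exists D : nat -> set T,
    [/\ forall i, closed (D i) /\ D i `<=` Y,
        forall i j, (i < j <= k)%N -> D i `&` D j = set0 &
        forall K, K `<=` Y -> crosses A B K -> forall i, (i <= k)%N ->
          exists2 K', crosses A' B' K' & K' `<=` K `&` D i].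
Proof.
move=> hT kT hi + + cA' + cB' + + AB'.
have I := @interior_subset T.
elim: k Y A B => [|k IH] Y A B cY cA cB AA' BB'.
  exists (fun=> Y); split; first by move=> _; split.
    by move=> i [//|j] /andP[_]; rewrite ?ltn0.
  move=> K KY cr i _; exists K; last by move=> x Kx; split => //; exact: KY.
  by apply: crossesS cr; [move=> x /AA'/I|move=> x /BB'/I].
have [A1 [cA1 AA1 A1A']] := normal_interpolate _ _ hT kT cA AA'.
have [B1 [cB1 BB1 B1B']] := normal_interpolate _ _ hT kT cB BB'.
have AB1 : A `&` B1 = set0.
  by rewrite -subset0 -AB' => x [/AA'/I ? /B1B'/I].
have BA1 : B `&` A1 = set0.
  by rewrite -subset0 -AB' => x [/BB'/I ? /A1A'/I].
have cP := closed_reach _ _ _ kT cY (@open_interior _ B1) cA.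
have cR := closed_reach _ _ _ kT cY (@open_interior _ A1) cB.
have PR := reach_disjoint Y A A1 B B1 hT kT hi cY AA1 BB1.
have [D [cD Ddis Dcr]] := IH _ A1 B1 cP cA1 cB1 A1A' B1B'.
have AS : A `<=` A1 by move=> x /AA1/I.
have BS : B `<=` B1 by move=> x /BB1/I.
exists (fun i => if i is j.+1 then D j else reach Y A1° B); split.
- have RY V (E : set T) : reach Y V E `<=` Y by move=> x [[]].
  by move=> [|i]; split => //; [case: (cD i)|case: (cD i) => _ /subset_trans; apply; exact: RY].
- move=> [|i] [|j] //; last exact: Ddis.
  move=> _; rewrite -subset0 -PR => x [Rx Dx]; split => //.
  by case: (cD j) => _; apply.
- move=> K KY cr [|i] ik.
    (* Index [0] uses the set reached from [B], so the ends of the crossing are exchanged and then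
       exchanged back. *)
    have [K' cr' K'K] := crosses_reach Y _ _ _ K hT kT cA1 AS BA1 KY (crossesC _ _ _ cr).
    exists K' => //; apply: crossesC; apply: crossesS cr'; first by move=> x /BB'/I.
    by move=> x /A1A'/I.
  have [K' cr' K'K] := crosses_reach Y _ _ _ K hT kT cB1 BS AB1 KY cr.
  have [||K2 cr2 K2K] := Dcr K' _ _ i ik.
  - by move=> x /K'K[].
  - by apply: crossesS cr'.
  by exists K2 => // x /K2K[/K'K[]].
Qed.

(** * Itineraries and the factor map onto the shift *)

Lemma continuous_iter {T : topologicalType} (f : T -> T) (n : nat) :
  continuous f -> continuous (iter n f).
Proof.
move=> cf; elim: n => [|n IH] x /=; first exact: cvg_id.
by apply: (continuous_comp (IH x)); exact: cf.
Qed.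

Lemma closed_iter_preimage {T : topologicalType} (f : T -> T) (n : nat) (A : set T) :
  continuous f -> closed A -> closed (iter n f @^-1` A).
Proof.
move=> cf; apply: preimage_closed => x _; exact: continuous_iter.
Qed.

Definition itinerary_domain {T : Type} {k : nat} (f : T -> T)
  (D : 'I_k -> set T) : set T := [set x | forall n, exists i, D i (iter n f x)].

(** The default [i0] makes the map total; on [itinerary_domain] the chosen index is always a genuine
    one. *)
Definition itinerary {T : Type} {k : nat} (i0 : 'I_k) (f : T -> T)
  (D : 'I_k -> set T) (x : T) : Sigma k :=
  fun n => xget i0 [set i | D i (iter n f x)].

Lemma closed_itinerary_domain {T : topologicalType} {k : nat} (f : T -> T)
  (D : 'I_k -> set T) :
  continuous f -> (forall i, closed (D i)) -> closed (itinerary_domain f D).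
Proof.
move=> cf cD.
have -> : itinerary_domain f D =
    \bigcap_(n in [set: nat]) (iter n f @^-1` \bigcup_(i in [set: 'I_k]) D i).
  apply/seteqP; split => x Dx n.
    by move=> _; have [i Di] := Dx n; exists i.
  by have [//|i _ Di] := Dx n; exists i.
apply: closed_bigI => n _; apply: closed_iter_preimage => //.
apply: closed_bigcup => [|i _]; [exact: finite_finset|exact: cD].
Qed.

Lemma itinerary_domain_stable {T : Type} {k : nat} (f : T -> T)
  (D : 'I_k -> set T) (x : T) :
  itinerary_domain f D x -> itinerary_domain f D (f x).
Proof. by move=> Dx n; have [i] := Dx n.+1; rewrite iterSr; exists i. Qed.

Lemma itineraryP {T : Type} {k : nat} (i0 : 'I_k) (f : T -> T)
  (D : 'I_k -> set T) (x : T) (n : nat) :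
  itinerary_domain f D x -> D (itinerary i0 f D x n) (iter n f x).
Proof.
by move=> Dx; exact: (@xgetPex _ i0 [set i | D i (iter n f x)] (Dx n)).
Qed.

Lemma itinerary_shift {T : Type} {k : nat} (i0 : 'I_k) (f : T -> T)
  (D : 'I_k -> set T) (x : T) :
  itinerary i0 f D (f x) = one_sided_shift (itinerary i0 f D x).
Proof.
apply: functional_extensionality_dep => n.
by rewrite /itinerary /one_sided_shift iterSr.
Qed.

Lemma itinerary_unique {T : Type} {k : nat} (i0 : 'I_k) (f : T -> T)
  (D : 'I_k -> set T) (x : T) (n : nat) (i : 'I_k) :
  (forall i j, i != j -> D i `&` D j = set0) ->
  D i (iter n f x) -> itinerary i0 f D x n = i.
Proof.
move=> Ddis Di; have Dit := @xgetI _ i0 [set i | D i (iter n f x)] i Di.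
apply/eqP/contraT => /Ddis e.
suff : set0 (iter n f x) by [].
by rewrite -e.
Qed.

(** Coordinatewise: near [x] the [n]-th iterate avoids the finitely many closed [D j] that miss the
    [n]-th iterate of [x], so on the domain the [n]-th symbol is locally constant. *)
Lemma within_continuous_itinerary {T : topologicalType} {k : nat} (i0 : 'I_k)
  (f : T -> T) (D : 'I_k -> set T) :
  continuous f -> (forall i, closed (D i)) ->
  (forall i j, i != j -> D i `&` D j = set0) ->
  {within itinerary_domain f D, continuous (itinerary i0 f D)}.
Proof.
move=> cf cD Ddis; apply/subspace_continuousP => x Xx.
apply/pointwise_cvgP => n /= A /= nA.
have Ax : A (itinerary i0 f D x n) by exact: nbhs_singleton nA.
set i := itinerary i0 f D x n in Ax *.
have nD : \forall y \near x, forall j, j != i -> ~ D j (iter n f y).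
  apply: filter_forall => j; have [->|ji] := eqVneq j i; first exact: nearW.
  apply: (@filterS _ _ _ (iter n f @^-1` ~` D j)); first by move=> y ? _.
  apply: (continuous_iter f n cf x); apply: open_nbhs_nbhs; split.
    exact: closed_openC.
  move=> Dj; suff : set0 (iter n f x) by [].
  by rewrite -(Ddis _ _ ji); split => //; exact: itineraryP.
apply: filterS nD => y nDy Xy.
suff yi : itinerary i0 f D y n = i by move: Ax; rewrite -yi.
by apply: contrapT => /eqP /nDy; apply; exact: itineraryP.
Qed.

(** [P] is later the class of crossing continua. A sequence of members following [s], each inside
    the image of the previous one, is pulled back along [f], and compactness gives one point with
    the whole itinerary. *)
Lemma itinerary_surjective {T : topologicalType} {k : nat} (i0 : 'I_k)
  (f : T -> T) (D : 'I_k -> set T) (P : set (set T)) (s : Sigma k) :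
  compact [set: T] -> continuous f ->
  (forall i j, i != j -> D i `&` D j = set0) ->
  P !=set0 -> (forall K, P K -> closed K /\ K !=set0) ->
  (forall K i, P K -> exists2 L, P L & L `<=` f @` K `&` D i) ->
  exists2 x, itinerary_domain f D x & itinerary i0 f D x = s.
Proof.
move=> kT cf Ddis [K0 PK0] Pcl Pstep.
have /choice[g gP] : forall q : set T * 'I_k,
    exists L, P q.1 -> P L /\ L `<=` f @` q.1 `&` D q.2.
  move=> [K i] /=; have [PK|nPK] := pselect (P K); last by exists set0.
  by have [L PL Lf] := Pstep K i PK; exists L.
(* The seed [K0] stands one step before time [0], so that [L 0] already lies in [D (s 0)]. *)
pose L := fix L n := if n is m.+1 then g (L m, s m.+1) else g (K0, s 0).
have PL n : P (L n) by elim: n => [|n IH] /=; [case: (gP (K0, s 0))|case: (gP (L n, s n.+1))].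
have LD n : L n `<=` D (s n).
  case: n => [|n] /= y.
    by have [_ h] := gP (K0, s 0) PK0; move=> /h[].
  by have [_ h] := gP (L n, s n.+1) (PL n); move=> /h[].
have Lf n : L n.+1 `<=` f @` L n.
  by move=> y /=; have [_ h] := gP (L n, s n.+1) (PL n); move=> /h[].
have pull n : forall y, L n y ->
    exists2 x, iter n f x = y & forall j, (j <= n)%N -> L j (iter j f x).
  elim: n => [|n IH] y Ly.
    by exists y => // j; rewrite leqn0 => /eqP ->.
  have [z Lz fz] := Lf n y Ly; have [x xz xL] := IH z Lz.
  exists x; first by rewrite iterS xz.
  move=> j; rewrite leq_eqVlt => /orP[/eqP ->|]; last exact: xL.
  by rewrite iterS xz fz.
(* [M n] holds the points following [L] up to time [n]; these sets decrease and [pull] makes them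
   nonempty. *)
pose M n := \bigcap_(j in [set j | (j <= n)%N]) (iter j f @^-1` L j).
have [|||x xM] := @compact_directed_meet T setT (range M) kT.
- by exists (M 0), 0.
- move=> _ [n _ <-]; split => //.
    by apply: closed_bigI => j _; apply: closed_iter_preimage => //; case: (Pcl _ (PL j)).
  have [_ [y /pull[x _ xL]]] := Pcl _ (PL n).
  by exists x => j; exact: xL.
- move=> _ _ [m _ <-] [n _ <-]; exists (M (maxn m n)); first by exists (maxn m n).
  move=> x xM; split => j jm; apply: xM => /=.
    by apply: leq_trans jm (leq_maxl _ _).
  by apply: leq_trans jm (leq_maxr _ _).
have xD n : D (s n) (iter n f x).
  by apply: LD; apply: (xM (M n)); [exists n|exact: leqnn].
exists x; first by move=> n; exists (s n).
by apply: functional_extensionality_dep => n; exact: itinerary_unique.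
Qed.

(** * Crossings of a taut chain *)

Lemma taut_closure_disjoint {T : topologicalType} (n : nat) (U : nat -> set T)
  (i j : nat) (x : T) :
  taut_chain_cover n U -> (0 < i)%N -> (i.+1 < j <= n)%N ->
  closure (U i) x -> closure (U j) x -> False.
Proof.
move=> [_ tU] i0 /andP[ij jn] Ui Uj.
have i1 : (1 <= i <= n)%N by rewrite i0 (leq_trans _ jn) // ltnW // ltnW.
have j1 : (1 <= j <= n)%N by rewrite jn andbT (leq_trans _ ij).
have [_] : i <= j.+1 /\ j <= i.+1 by apply/(tU i j i1 j1); exists x.
by rewrite leqNgt ij.
Qed.

Lemma closure_sub_closed {T : topologicalType} (A B : set T) :
  closed B -> A `<=` B -> closure A `<=` B.
Proof. by move=> cB AB x /(closureS AB); exact: cB. Qed.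

(** Bump twice: off the links after [U 4], starting at the left end, then off the links before it,
    starting at the point [c] where the first piece touches [closure V]. What remains lies in
    [U 4]. *)
Lemma crosses_middle {T : topologicalType} (U : nat -> set T) (K : set T) :
  hausdorff_space T -> compact [set: T] -> taut_chain_cover 7 U ->
  crosses (closure (U 1) `|` closure (U 2)) (closure (U 6) `|` closure (U 7)) K ->
  exists2 L, crosses (closure (U 3)) (closure (U 5)) L &
    L `<=` K `&` closure (U 4).
Proof.
move=> hT kT tU [sK [a [Ka Aa]] [b [Kb Bb]]].
have dis i j x := @taut_closure_disjoint T 7 U i j x tU.
have [[oU [cov _]] _] := tU.
have sub i : U i `<=` closure (U i) by exact: subset_closure.
pose V := U 5 `|` (U 6 `|` U 7); pose W := U 1 `|` (U 2 `|` U 3).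
have oV : open V by do 2?apply: openU; exact: oU.
have oW : open W by do 2?apply: openU; exact: oU.
have clV : closure V = closure (U 5) `|` (closure (U 6) `|` closure (U 7)).
  by rewrite !closureU.
have clW : closure W = closure (U 1) `|` (closure (U 2) `|` closure (U 3)).
  by rewrite !closureU.
have VW x : ~ V x -> ~ W x -> U 4 x.
  move=> nV nW; have [i /andP[i0 i7] Ux] := cov x.
  move: i i0 i7 Ux => [//|[|[|[|[//|[|[|[|//]]]]]]]] _ _ Ux; exfalso.
  - by apply: nW; left.
  - by apply: nW; right; left.
  - by apply: nW; right; right.
  - by apply: nV; left.
  - by apply: nV; right; left.
  - by apply: nV; right; right.
have closedKV (L X : set T) : subcontinuum L -> open X -> closed (L `\` X).
  move=> [_ [kL _]] oX; apply: closedI; first exact: compact_closed.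
  exact: open_closedC.
have nVa : ~ V a.
  by case: Aa => Aa [/sub|[/sub|/sub]]; apply: dis Aa.
have [||sK1 [c [K1c Fc]]] :=
    subcontinuum_bump K V (closure V) a hT kT sK oV (@closed_closure _ V) _ Ka nVa.
- exact: subset_closure.
- by exists b; split => //; rewrite clV; right.
set K1 := quasicomponent _ _ in sK1 K1c.
have K1K : K1 `<=` K `\` V by apply: quasicomponent_sub => //; exact: closedKV.
have [Kc nVc] := K1K _ K1c.
(* Off [V], the point [c] lies in one of the first four links, whose closures miss those of [U 6]
   and [U 7]. *)
have U5c : closure (U 5) c.
  have nU67 : closure (U 6) c \/ closure (U 7) c -> False.
    have Uc : W c \/ U 4 c.
      by have [Wc|nWc] := pselect (W c); [left|right; exact: VW].
    by case: Uc => [[/sub|[/sub|/sub]]|/sub] Uc [] Uc'; apply: dis Uc Uc'.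
  by move: Fc; rewrite clV => -[//|/nU67].
have nWc : ~ W c.
  by move=> [/sub|[/sub|/sub]] Uc; apply: dis Uc U5c.
have [||sK2 [e [K2e Fe]]] :=
    subcontinuum_bump K1 W (closure W) c hT kT sK1 oW (@closed_closure _ W) _ K1c nWc.
- exact: subset_closure.
- exists a; split; first exact: quasicomponent_refl.
  by rewrite clW; case: Aa => ?; [left|right; left].
set K2 := quasicomponent _ _ in sK2 K2e.
have K2K1 : K2 `<=` K1 `\` W by apply: quasicomponent_sub => //; exact: closedKV.
have K2U x : K2 x -> U 4 x.
  by move=> /K2K1[/K1K[_ nV] nW]; exact: VW.
exists K2; last first.
  move=> x K2x; split; last by apply: sub; exact: K2U.
  by have [/K1K[]] := K2K1 _ K2x.
split => //.
- exists e; split => //; move: Fe; rewrite clW => -[|[|//]] Ue; exfalso.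
  + by apply: dis Ue (sub _ _ (K2U _ K2e)).
  + by apply: dis Ue (sub _ _ (K2U _ K2e)).
- by exists c; split => //; exact: quasicomponent_refl.
Qed.

(** Continuity extends both inclusions to closures; the two orientations agree since [crosses] only
    asks that both ends be met. *)
Lemma stretches_crosses {T : topologicalType} (f : T -> T) (U : nat -> set T)
  (K : set T) :
  continuous f -> stretches f U -> crosses (closure (U 3)) (closure (U 5)) K ->
  crosses (closure (U 1)) (closure (U 7)) (f @` K).
Proof.
move=> cf sf [[[x Kx] [kK nK]] [a [Ka Ua]] [b [Kb Ub]]].
have fcl i j : f @` U i `<=` U j -> closure (U i) `<=` f @^-1` closure (U j).
  move=> fij; apply: closure_sub_closed.
    by apply: preimage_closed; [move=> ? _; exact: cf|exact: closed_closure].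
  by move=> y Uy; apply: subset_closure; apply: fij; exists y.
have wf : {within K, continuous f} by exact: continuous_subspaceT.
split.
- split; first by exists (f x), x.
  split; first exact: continuous_compact.
  exact: connected_continuous_connected.
- case: sf => -[f1 f7].
    by exists (f a); split; [exists a|exact: fcl f1 _ Ua].
  by exists (f b); split; [exists b|exact: fcl f1 _ Ub].
- case: sf => -[f1 f7].
    by exists (f b); split; [exists b|exact: fcl f7 _ Ub].
  by exists (f a); split; [exists a|exact: fcl f7 _ Ua].
Qed.

Lemma taut_crossing_family {T : topologicalType} (k : nat) (U : nat -> set T) :
  hausdorff_space T -> compact [set: T] -> hereditarily_indecomposable T ->
  taut_chain_cover 7 U ->
  exists D : nat -> set T,
    [/\ forall i, closed (D i) /\ D i `<=` closure (U 4),
        forall i j, (i < j <= k)%N -> D i `&` D j = set0 &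
        forall K, crosses (closure (U 1)) (closure (U 7)) K ->
          forall i, (i <= k)%N ->
          exists2 L, crosses (closure (U 3)) (closure (U 5)) L & L `<=` K `&` D i].
Proof.
move=> hT kT hi tU.
have dis i j x := @taut_closure_disjoint T 7 U i j x tU.
have [[oU [cov _]] _] := tU.
have sub i : U i `<=` closure (U i) by exact: subset_closure.
have cc (A : set T) : closed (closure A) by exact: closed_closure.
(* Tautness keeps the closure of an end link inside the open union of that link and its neighbour,
   so adding the closed neighbour gives a closed neighbourhood. *)
have end_interior i j : (0 < i <= 7)%N -> (0 < j <= 7)%N ->
    closure (U i) `<=` U i `|` U j -> closure (U i) `<=` (closure (U i) `|` closure (U j))°.
  move=> i7 j7 Uij x /Uij Ux.
  suff : (U i `|` U j)° x by apply: interiorS => y [/sub|/sub]; [left|right].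
  by rewrite (interior_id _).1 //; apply: openU; exact: oU.
have [||||||||D [cD Ddis Dcr]] := @crossing_family T k setT (closure (U 1))
  (closure (U 1) `|` closure (U 2)) (closure (U 7)) (closure (U 7) `|` closure (U 6)) hT kT hi.
- exact: closedT.
- exact: cc.
- by apply: closedU; exact: cc.
- exact: cc.
- by apply: closedU; exact: cc.
- apply: end_interior => // x U1x; have [i /andP[i0 i7] Ux] := cov x.
  move: i i0 i7 Ux => [//|[|[|i]]] _ i7 Ux; [by left|by right|].
  by exfalso; apply: (dis 1 i.+3) U1x (sub _ _ Ux).
- apply: end_interior => // x U7x; have [i /andP[i0 i7] Ux] := cov x.
  move: i i0 i7 Ux => [//|[|[|[|[|[|[|[|//]]]]]]]] _ _ Ux; [..|by right|by left];
    by exfalso; apply: dis (sub _ _ Ux) U7x.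
- by rewrite -subset0 => x [[] Ax [] Bx]; apply: dis Ax Bx.
exists (fun i => D i `&` closure (U 4)); split.
- move=> i; split; last exact: subIsetr.
  by apply: closedI; [case: (cD i)|exact: cc].
- by move=> i j /Ddis Dij; rewrite setIACA Dij set0I.
- move=> K crK i ik; have [//|K' crK' K'K] := Dcr K _ crK i ik.
  rewrite (setUC (closure (U 7))) in crK'.
  have [L crL LK'] := crosses_middle U K' hT kT tU crK'.
  exists L => // x /LK'[/K'K[Kx Dx] U4x]; by split.
Qed.

(** * The horseshoe and its itineraries *)

Theorem theorem10p2 (R : realType) (C : pseudoMetricType R)
  (U : nat -> set C) (f : C -> C) :
  pseudo_arc C -> taut_chain_cover 7 U -> continuous f -> stretches f U ->
  forall k : nat, (2 <= k)%N ->
  exists D : set C,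
    closed D /\ D `<=` closure (U 4) /\ f @` D `<=` D /\
    exists pi : C -> Sigma k,
      {within D, continuous pi} /\
      (forall s : Sigma k, exists2 x, D x & pi x = s) /\
      (forall x, D x -> pi (f x) = one_sided_shift (pi x)).
Proof.
move=> [[hC [kC [nC _]]] [_ hi]] tU cf sf k k2.
(* This gives [k.+1] disjoint sets, of which ['I_k] indexes the first [k]. *)
have [E [cE Edis Ecr]] := taut_crossing_family k U hC kC hi tU.
have i0 : 'I_k by exists 0; exact: leq_trans k2.
pose D (i : 'I_k) := E i.
have cD i : closed (D i) by case: (cE i).
have Ddis i j : i != j -> D i `&` D j = set0.
  move=> ij; wlog lij : i j ij / (i < j)%N.
    move=> wl; case: (ltngtP i j) => [|ji|/val_inj e]; first exact: wl.
      by rewrite setIC; apply: wl => //; rewrite eq_sym.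
    by rewrite e eqxx in ij.
  by apply: Edis; rewrite lij ltnW.
exists (itinerary_domain f D); split; first exact: closed_itinerary_domain.
split.
  by move=> x /(_ 0)[i Dx]; have [_] := cE i; apply.
split; first by move=> _ [x Dx <-]; exact: itinerary_domain_stable.
exists (itinerary i0 f D); split; first exact: within_continuous_itinerary.
split; last by move=> x _; exact: itinerary_shift.
move=> s; apply: (@itinerary_surjective _ _ i0 f D
  (crosses (closure (U 3)) (closure (U 5)))) => //.
(* The seed comes from [C] itself, a continuum that meets both end links. *)
- have Une i : (0 < i <= 7)%N -> exists x, closure (U i) x.
    move=> i7; have [[_ [_ ch]] _] := tU.
    have [x [Ux _]] : U i `&` U i !=set0 by apply/(ch i i i7 i7).
    by exists x; exact: subset_closure.
  have [L crL _] : exists2 L, crosses (closure (U 3)) (closure (U 5)) L &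
      L `<=` setT `&` E 0.
    apply: Ecr => //.
    have [a Ua] := Une 1 isT; have [b Ub] := Une 7 isT.
    split; [|by exists a|by exists b].
    by split; [exists a|split].
  by exists L.
- move=> K [[K0 [kK _]] _ _]; split => //; exact: compact_closed.
(* Stretching closes the loop: the image of a crossing piece crosses the whole chain, so it contains
   a new piece in every [D i]. *)
- move=> K i crK; apply: Ecr; last exact: ltnW.
  exact: stretches_crosses.
Qed.
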